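(* Every finite ultrametric space embeds isometrically into $(\mathcal{U},u_{\mathrm{GH}})$, the collection of all compact ultrametric spaces (up to isometry) endowed with the Gromov-Hausdorff ultrametric.
   Context: An ultrametric space is a metric space $(X,u_X)$ satisfying the strong triangle inequality $u_X(x,z)\le\max(u_X(x,y),u_X(y,z))$ for all $x,y,z\in X$. An isometric embedding is a distance-preserving map (not necessarily surjective). $\mathcal{U}$ denotes the collection of all (nonempty) compact ultrametric spaces, with isometric spaces identified. For $X,Y\in\mathcal{U}$, the Gromov-Hausdorff ultrametric is $$u_{\mathrm{GH}}(X,Y):=\inf_Z d_{\mathrm{H}}^Z(X,Y),$$ where the infimum is over all ultrametric spaces $Z$ and all isometric embeddings of $X$ into $Z$ and of $Y$ into $Z$, and $d_{\mathrm{H}}^Z$ is the Hausdorff distance in $Z$ between the images. It is known that $(\mathcal{U},u_{\mathrm{GH}})$ is an ultrametric space. *)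

(* Defs.v *)
From mathcomp Require Import all_boot all_order all_algebra.
From mathcomp Require Import boolp classical_sets functions cardinality reals.
From mathcomp Require Import topology.

Set Implicit Arguments.
Unset Strict Implicit.
Unset Printing Implicit Defensive.

Import Order.TTheory GRing.Theory Num.Theory.

Local Open Scope classical_set_scope.
Local Open Scope ring_scope.

Definition ultrametric (R : realType) (X : metricType R) : Prop :=
  forall x y z : X, mdist x z <= Num.max (mdist x y) (mdist y z).

Definition isometric_embedding (R : realType) (X Y : metricType R)
    (f : X -> Y) : Prop :=
  forall x y : X, mdist (f x) (f y) = mdist x y.

(* The infimum of the r > 0 such that each set lies in the open
   r-neighbourhood of the other.  [inf] is real-valued, so this is the Hausdorff
   distance only when such an r exists, e.g. for nonempty bounded sets; below it
   is only used on nonempty compact sets. *)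
Definition hausdorff_dist (R : realType) (Z : metricType R) (A B : set Z) : R :=
  inf [set r : R | [/\ 0 < r,
                       A `<=` \bigcup_(b in B) ball b r &
                       B `<=` \bigcup_(a in A) ball a r]].

Record compact_ultrametric_space (R : realType) := CompactUltrametricSpace {
  cus_space :> metricType R ;
  cus_nonempty : [set: cus_space] !=set0 ;
  cus_compact : compact [set: cus_space] ;
  cus_ultrametric : ultrametric cus_space }.

Definition isometric (R : realType) (X Y : compact_ultrametric_space R) : Prop :=
  exists f : X -> Y, isometric_embedding f /\ range f = [set: Y].

(* The collection of compact ultrametric spaces, isometric ones identified: the
   quotient by [isometric], as a type of equivalence classes.  [{eq_quot _}] and
   [set (compact_ultrametric_space R)] are ruled out by universe constraints. *)
Record ultra_class (R : realType) := UltraClass {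
  ultra_class_mem :> compact_ultrametric_space R -> Prop ;
  ultra_classP : exists X, ultra_class_mem = isometric X }.

Lemma ultra_class_inhabited (R : realType) (A : ultra_class R) :
  exists X, A X.
Proof.
case: A => P [X /= ->]; exists X; exists id; split; first by [].
by rewrite image_id.
Qed.

Definition ultra_class_repr (R : realType) (A : ultra_class R) :
    compact_ultrametric_space R :=
  projT1 (cid (ultra_class_inhabited A)).

Definition u_GH_space (R : realType) (X Y : compact_ultrametric_space R) : R :=
  inf [set r : R | exists (Z : metricType R) (f : X -> Z) (g : Y -> Z),
         [/\ ultrametric Z, isometric_embedding f, isometric_embedding g &
             r = hausdorff_dist (range f) (range g)]].

(* [u_GH_space] is invariant under isometry, so the choice of the
   representatives is immaterial. *)
Definition u_GH (R : realType) (A B : ultra_class R) : R :=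
  u_GH_space (ultra_class_repr A) (ultra_class_repr B).

(* Main.v *)
(* A weight function w on a finite set T makes T an ultrametric space, its
   "star", with d(p, q) = max(w p, w q) for p <> q.  The point x of X is sent
   to the star on a common set of labels, each label lying over a point z of X
   and having weight u(x, z) (a tiny e > 0 if z = x).  The weights for x and y
   agree wherever one of them exceeds u(x, y), so the two stars sit in a larger
   star at Hausdorff distance at most u(x, y).  Conversely, let t = u(x, y).  If
   the two stars were at distance less than t, their largest t-separated
   subsets, hence the numbers of labels of weight less than t, would have the
   same size.  These are the labels lying over the open t-balls around x and
   y, which are disjoint; placing 2 ^ i labels over the i-th point of X makes
   the two numbers different. *)
Require Import Defs.
From HB Require Import structures.
From mathcomp Require Import all_boot all_order all_algebra.
From mathcomp Require Import boolp classical_sets functions cardinality reals.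
From mathcomp Require Import interval_inference topology.

Set Implicit Arguments.
Unset Strict Implicit.
Unset Printing Implicit Defensive.

Import Order.TTheory GRing.Theory Num.Theory.

Local Open Scope classical_set_scope.
Local Open Scope ring_scope.

(** An alias of [T] that mentions [w], so that the metric instance declared on it can depend on the
    weights. *)
Definition star (R : realType) (T : choiceType) (w : T -> {posnum R}) : Type := T.

(** * Stars as ultrametric spaces *)

Section Star.
Variables (R : realType) (T : choiceType) (w : T -> {posnum R}).

HB.instance Definition _ := Choice.on (star w).

Definition star_dist (p q : star w) : R :=
  if p == q then 0 else Num.max (w p)%:num (w q)%:num.

Lemma star_distxx p : star_dist p p = 0.
Proof. by rewrite /star_dist eqxx. Qed.

Lemma star_dist_eq0 p q : star_dist p q = 0 -> p = q.
Proof.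
rewrite /star_dist; case: eqVneq => // _ /eqP.
by rewrite gt_eqF// lt_max gt0.
Qed.

Lemma star_dist_sym p q : star_dist p q = star_dist q p.
Proof. by rewrite /star_dist eq_sym maxC. Qed.

Lemma star_dist_ge0 p q : 0 <= star_dist p q.
Proof. by rewrite /star_dist; case: ifP => // _; rewrite le_max ge0. Qed.

Lemma star_dist_ultra p q r :
  star_dist p r <= Num.max (star_dist p q) (star_dist q r).
Proof.
have [->|pq] := eqVneq p q; first by rewrite le_max lexx orbT.
have [->|qr] := eqVneq q r; first by rewrite le_max lexx.
rewrite /star_dist (negbTE pq) (negbTE qr); case: ifP => _.
  by rewrite !le_max ge0.
by rewrite ge_max !le_max !lexx !orbT.
Qed.

Lemma star_dist_triangle q p r : star_dist p r <= star_dist p q + star_dist q r.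
Proof.
apply: le_trans (star_dist_ultra p q r) _.
by rewrite ge_max lerDl lerDr !star_dist_ge0.
Qed.

HB.instance Definition _ := isMetric.Build R (star w)
  star_distxx star_dist_eq0 star_dist_sym star_dist_triangle.

Lemma star_ultrametric : ultrametric (star w).
Proof. exact: star_dist_ultra. Qed.

End Star.

Lemma star_compact (R : realType) (T : finType) (w : T -> {posnum R}) :
  compact [set: star w].
Proof. by apply: finite_compact; apply: (@finite_finset T). Qed.

Definition star_cus (R : realType) (T : finType) (w : T -> {posnum R}) (t0 : T) :
  compact_ultrametric_space R :=
  @CompactUltrametricSpace R (star w) (ex_intro _ t0 I)
    (@star_compact R T w) (@star_ultrametric R T w).

(** * Gromov-Hausdorff distance of classes and of stars *)

Section GromovHausdorff.
Variable R : realType.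

Lemma isometric_sym (X Y : compact_ultrametric_space R) :
  isometric X Y -> isometric Y X.
Proof.
move=> [f [f_iso f_surj]].
have [g gK] : {g : Y -> X & forall y, f (g y) = y}.
  apply: (@choice _ _ (fun y x => f x = y)) => y.
  have [x _ <-] : range f y by rewrite f_surj.
  by exists x.
exists g; split=> [y y'|]; first by rewrite -f_iso !gK.
apply/seteqP; split=> // x _; exists (f x) => //.
by apply: mdist_positivity; rewrite -f_iso gK mdistxx.
Qed.

(** Precomposing a coupling with surjective isometries keeps both images, hence the Hausdorff
    distance. *)
Lemma u_GH_space_isometric (X X' Y Y' : compact_ultrametric_space R) :
  isometric X X' -> isometric Y Y' -> u_GH_space X Y = u_GH_space X' Y'.
Proof.
have incl X1 X2 Y1 Y2 : isometric X2 X1 -> isometric Y2 Y1 ->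
    [set r : R | exists (Z : metricType R) (f : X1 -> Z) (g : Y1 -> Z),
         [/\ ultrametric Z, isometric_embedding f, isometric_embedding g &
             r = hausdorff_dist (range f) (range g)]] `<=`
    [set r : R | exists (Z : metricType R) (f : X2 -> Z) (g : Y2 -> Z),
         [/\ ultrametric Z, isometric_embedding f, isometric_embedding g &
             r = hausdorff_dist (range f) (range g)]].
  move=> [h [h_iso h_surj]] [k [k_iso k_surj]] r [Z [f [g [Zu fi gi ->]]]].
  exists Z, (f \o h), (g \o k); split=> //.
  - by move=> p q; rewrite /= fi h_iso.
  - by move=> p q; rewrite /= gi k_iso.
  - by rewrite -h_surj -k_surj !image_comp.
move=> XX' YY'; rewrite /u_GH_space; congr inf; apply/seteqP.
by split; apply: incl => //; apply: isometric_sym.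
Qed.

Definition class_of (X : compact_ultrametric_space R) : ultra_class R :=
  UltraClass (ex_intro (fun Y => isometric X = isometric Y) X erefl).

Lemma u_GH_class_of (X Y : compact_ultrametric_space R) :
  u_GH (class_of X) (class_of Y) = u_GH_space X Y.
Proof.
by apply/esym/u_GH_space_isometric; rewrite /ultra_class_repr; case: cid.
Qed.

Lemma hausdorff_dist_ge0 (Z : metricType R) (A B : set Z) :
  0 <= hausdorff_dist A B.
Proof.
rewrite /hausdorff_dist; set S := [set r | _].
have [->|/set0P S0] := eqVneq S set0; first by rewrite inf0.
by apply: lb_le_inf => // r [/ltW].
Qed.

Lemma hausdorff_dist_lt (Z : metricType R) (S T : finType) (s0 : S) (t0 : T)
    (f : S -> Z) (g : T -> Z) (t : R) :
  hausdorff_dist (range f) (range g) < t ->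
  exists r, [/\ r < t, forall p, exists q, mdist (f p) (g q) < r &
                       forall q, exists p, mdist (g q) (f p) < r].
Proof.
set S0 := [set r | [/\ 0 < r, range f `<=` \bigcup_(b in range g) ball b r &
                       range g `<=` \bigcup_(a in range f) ball a r]].
(* With no admissible radius, [inf] would take its default value 0. The sum of all distances, plus
   1, is admissible. *)
have S0P : S0 !=set0.
  pose M := \sum_p \sum_q mdist (f p) (g q).
  have M_ge p q : mdist (f p) (g q) <= M.
    rewrite /M (bigD1 p)//= (bigD1 q)//= -addrA lerDl addr_ge0//.
      by apply: sumr_ge0 => *; apply: mdist_ge0.
    by do 2!apply: sumr_ge0 => *; apply: mdist_ge0.
  exists (M + 1); split.
  - by rewrite ltr_wpDl//; do 2!apply: sumr_ge0 => *; apply: mdist_ge0.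
  - move=> _ [p _ <-]; exists (g t0); first by exists t0.
    by rewrite ballEmdist /= metric_sym ltr_pwDr.
  - move=> _ [q _ <-]; exists (f s0); first by exists s0.
    by rewrite ballEmdist /= ltr_pwDr.
move=> /(inf_lt S0P) [r [_ fg gf] rt].
exists r; split=> // [p|q].
- have [|_ [q _ <-]] := fg (f p); first by exists p.
  by rewrite ballEmdist /= metric_sym; exists q.
- have [|_ [p _ <-]] := gf (g q); first by exists q.
  by rewrite ballEmdist /= metric_sym; exists p.
Qed.

Lemma hausdorff_dist_le (Z : metricType R) (T : Type) (f g : T -> Z) (t : R) :
  0 <= t -> (forall p, mdist (f p) (g p) <= t) ->
  hausdorff_dist (range f) (range g) <= t.
Proof.
(* The neighbourhoods are open, so [t] itself may fail to be admissible, but every [t + e] is. *)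
move=> t0 fg; apply/ler_addgt0Pr => e e0; apply: ge_inf.
  by exists 0 => r [/ltW].
split; first by rewrite ltr_wpDl.
- move=> _ [p _ <-]; exists (g p); first by exists p.
  by rewrite ballEmdist /= metric_sym (le_lt_trans (fg p)) // ltrDl.
- move=> _ [p _ <-]; exists (f p); first by exists p.
  by rewrite ballEmdist /= (le_lt_trans (fg p)) // ltrDl.
Qed.

Lemma u_GH_space_ge0 (X Y : compact_ultrametric_space R) : 0 <= u_GH_space X Y.
Proof.
rewrite /u_GH_space; set S := [set r | _].
have [->|/set0P S0] := eqVneq S set0; first by rewrite inf0.
apply: lb_le_inf => // _ [? [? [? [_ _ _ ->]]]]; exact: hausdorff_dist_ge0.
Qed.

(** The larger star lives on pairs of a label and a weight, and both stars embed as the graphs of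
    their weight functions. A label with equal weights has a single image; otherwise its two images
    are at distance the larger weight. *)
Lemma star_coupling (T : choiceType) (w v : T -> {posnum R}) :
  exists (Z : metricType R) (f : star w -> Z) (g : star v -> Z),
    [/\ ultrametric Z, isometric_embedding f, isometric_embedding g &
        forall (l : T) t, 0 <= t ->
          w l = v l \/ (w l)%:num <= t /\ (v l)%:num <= t ->
          mdist (f l) (g l) <= t].
Proof.
exists (star (fun p : T * {posnum R} => p.2)).
exists (fun l => (l, w l)), (fun l => (l, v l)).
split; first exact: star_ultrametric.
- move=> p q; rewrite /mdist/= /star_dist xpair_eqE.
  by case: eqVneq => [->|]; rewrite ?eqxx.
- move=> p q; rewrite /mdist/= /star_dist xpair_eqE.
  by case: eqVneq => [->|]; rewrite ?eqxx.
move=> l t t0; rewrite /mdist/= /star_dist xpair_eqE eqxx/=.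
case=> [->|[wt vt]]; first by rewrite eqxx.
by case: ifP => // _; rewrite ge_max wt.
Qed.

Lemma u_GH_star_le (T : finType) (t0 : T) (w v : T -> {posnum R}) (t : R) :
  0 <= t ->
  (forall l, w l = v l \/ (w l)%:num <= t /\ (v l)%:num <= t) ->
  u_GH_space (star_cus w t0) (star_cus v t0) <= t.
Proof.
move=> t_ge0 wv; have [Z [f [g [Zu fi gi fg]]]] := star_coupling w v.
apply: le_trans (@hausdorff_dist_le Z T f g t t_ge0 _).
  apply: ge_inf; last by exists Z, f, g.
  by exists 0 => _ [? [? [? [_ _ _ ->]]]]; exact: hausdorff_dist_ge0.
by move=> l; apply: fg.
Qed.

(* A set of points at pairwise distance at least [t] contains at most one point
   of weight less than [t], and correspondences of distortion less than [t]
   preserve such sets. *)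
Lemma leq_card_heavy (T : finType) (w v : T -> {posnum R}) (t r : R)
    (Z : metricType R) (f : star w -> Z) (g : star v -> Z) :
  ultrametric Z -> isometric_embedding f -> isometric_embedding g ->
  (exists l, (w l)%:num < t) -> r < t ->
  (forall p, exists q, mdist (f p) (g q) < r) ->
  (#|[set l | (t <= (w l)%:num)%R]%SET| <=
   #|[set l | (t <= (v l)%:num)%R]%SET|)%N.
Proof.
move=> Zu fi gi [l0 l0t] rt /choice[h hP].
set W := [set l | t <= (w l)%:num]%SET.
set V := [set l | t <= (v l)%:num]%SET.
have l0W : l0 \notin W by rewrite inE -ltNge.
(* Of two distinct points of [l0 |: W] one is heavy, so this set is [t]-separated. Its image under
   [h] is too: otherwise the path [f p], [g (h p)], [g (h q)], [f q] would have all links shorter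
   than [t]. *)
have sep p q : p != q -> p \in l0 |: W -> q \in l0 |: W ->
    t <= star_dist (h p : star v) (h q).
  move=> pq pS qS; have : t <= mdist (f p) (f q).
    rewrite fi /mdist/= /star_dist (negbTE pq) le_max.
    move: pS qS pq; rewrite !inE => /orP[/eqP ->|->//] /orP[/eqP ->|->].
      by rewrite eqxx.
    by rewrite orbT.
  have := Zu (f p) (g (h q)) (f q); have := Zu (f p) (g (h p)) (g (h q)).
  rewrite gi [mdist (g (h q)) (f q)]metric_sym => H1 H2 tle.
  rewrite leNgt; apply/negP => lt_t.
  have : mdist (f p) (f q) < t.
    apply: le_lt_trans H2 _; rewrite gt_max (lt_trans (hP q) rt) andbT.
    by apply: le_lt_trans H1 _; rewrite gt_max (lt_trans (hP p) rt).
  by rewrite ltNge tle.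
have t_gt0 : 0 < t by apply: lt_trans l0t.
have h_inj : {in l0 |: W &, injective h}.
  move=> p q pS qS hpq; apply/eqP/negPn/negP => /sep/(_ pS qS).
  by rewrite hpq star_distxx leNgt t_gt0.
(* The separated image has at most one point outside [V]; the [+ 1] is matched by [l0] on the other
   side. *)
have : (#|h @: (l0 |: W)| <= #|V|.+1)%N.
  have [q0 q0P|lightN] := pickP [pred q in h @: (l0 |: W) | q \notin V].
    move: q0P => /= /andP[/imsetP[p0 p0S ->]]; rewrite inE -ltNge => p0t.
    apply: leq_trans (_ : #|h p0 |: V| <= _)%N; last first.
      by rewrite cardsU1 -add1n leq_add2r leq_b1.
    apply/subset_leq_card/fintype.subsetP => _ /imsetP[p pS ->]; rewrite !inE.
    have [->|hpq] := eqVneq p p0; first by rewrite eqxx.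
    have /= := sep _ _ hpq pS p0S; rewrite /star_dist; case: ifP => // _.
    by rewrite le_max [t <= (v (h p0))%:num]leNgt p0t orbF.
  apply/leqW/subset_leq_card/fintype.subsetP => q qS.
  by have := lightN q; rewrite /= qS /= => /negbFE.
by rewrite card_in_imset// cardsU1 l0W ltnS.
Qed.

Lemma u_GH_star_lt (T : finType) (t0 : T) (w v : T -> {posnum R}) (t : R) :
  (exists l, (w l)%:num < t) -> (exists l, (v l)%:num < t) ->
  u_GH_space (star_cus w t0) (star_cus v t0) < t ->
  #|[set l | t <= (w l)%:num]%SET| = #|[set l | t <= (v l)%:num]%SET|.
Proof.
move=> wt vt; move/inf_lt => [|r [Z [f [g [Zu fi gi ->]]]]].
  have [Z [f [g [Zu fi gi _]]]] := star_coupling w v.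
  by exists (hausdorff_dist (range f) (range g)), Z, f, g.
move=> /(@hausdorff_dist_lt Z T T t0 t0)[r' [r't fg gf]].
apply/eqP; rewrite eqn_leq (leq_card_heavy Zu fi gi wt r't fg).
exact: leq_card_heavy Zu gi fi vt r't gf.
Qed.

End GromovHausdorff.

(** * Labellings that tell disjoint sets apart by counting *)

Lemma ltn_card_trunc_log (n i : nat) (A B : pred nat) :
  (i < n)%N -> A i -> (forall j, B j -> (j < i)%N) ->
  (#|[pred m : 'I_(2 ^ n).-1 | B (trunc_log 2 m.+1)]| <
   #|[pred m : 'I_(2 ^ n).-1 | A (trunc_log 2 m.+1)]|)%N.
Proof.
move=> i_n Ai B_i; have i2 : (0 < 2 ^ i)%N by rewrite expn_gt0.
have i2n : (2 ^ i.+1 <= 2 ^ n)%N by rewrite leq_exp2l.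
(* The levels below [i] hold [2 ^ i - 1] labels altogether, one fewer than level [i] alone. *)
apply: (@leq_trans (2 ^ i)).
  rewrite -(prednK i2) ltnS.
  have le_n : ((2 ^ i).-1 <= (2 ^ n).-1)%N.
    by rewrite -!subn1 leq_sub2r// leq_exp2l// ltnW.
  have inj : injective (widen_ord le_n) by move=> k k' /(congr1 val) /= /val_inj.
  rewrite -[leqRHS]card_ord -(fintype.card_image inj).
  apply/subset_leq_card/fintype.subsetP => m /B_i lt_i.
  have m_i : (m < (2 ^ i).-1)%N.
    rewrite -ltnS prednK//; apply: leq_trans (@trunc_log_ltn 2 m.+1 _) _ => //.
    by rewrite leq_exp2l.
  by apply/fintype.imageP; exists (Ordinal m_i) => //; apply: val_inj.
(* Level [i] is the block of [2 ^ i] labels starting at [2 ^ i - 1]. *)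
have lt_n (k : 'I_(2 ^ i)) : ((2 ^ i).-1 + k < (2 ^ n).-1)%N.
  rewrite -ltnS prednK ?expn_gt0// -addSn prednK//.
  by apply: leq_trans i2n; rewrite expnS mul2n -addnn ltn_add2l.
have inj : injective (fun k => Ordinal (lt_n k)).
  by move=> k k' /(congr1 val)/addnI/val_inj.
rewrite -[leqLHS]card_ord -(fintype.card_image inj).
apply/subset_leq_card/fintype.subsetP => _ /fintype.imageP[k _ ->]; rewrite inE /=.
rewrite -addSn prednK// (@trunc_log_eq _ i)// leq_addr/=.
by rewrite expnS mul2n -addnn ltn_add2l.
Qed.

(* The labels are the numbers [1 <= m < 2 ^ n], shifted by one; exactly [2 ^ i]
   of them satisfy [trunc_log 2 m = i]. *)
Lemma separating_labelling (X : choiceType) (x0 : X) :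
  finite_set [set: X] ->
  exists (L : finType) (pt : L -> X), forall A B : pred X,
    (forall x, A x -> ~~ B x) -> (exists x, A x) ->
    #|[pred l | A (pt l)]| <> #|[pred l | B (pt l)]|.
Proof.
move=> /finite_seqP[s sE].
have in_s x : x \in s by have : [set: X] x by []; rewrite sE.
pose pt i := nth x0 s i.
exists 'I_(2 ^ size s).-1, (fun m : 'I__ => pt (trunc_log 2 m.+1)) => A B AB [x Ax] eqAB.
(* The set containing the point of largest index in the union has more labels: by disjointness, the
   other set only has smaller indices. *)
pose P i := (i < size s)%N && (A (pt i) || B (pt i)).
have exP : exists i, P i.
  by exists (index x s); rewrite /P index_mem in_s /pt nth_index// Ax.
have Ple i : P i -> (i <= size s)%N by case/andP=> /ltnW.
case: (ex_maxnP exP Ple) => i /andP[i_s ABi] i_max.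
(* No label reaches the default value of [nth]. *)
have size_lt (m : 'I_(2 ^ size s).-1) : (trunc_log 2 m.+1 < size s)%N.
  have : (2 ^ trunc_log 2 m.+1 < 2 ^ size s)%N.
    apply: leq_ltn_trans (trunc_logP _ _) _ => //.
    by rewrite -[ltnRHS]prednK ?expn_gt0// ltnS.
  by rewrite ltn_exp2l.
have card_in (C : pred X) :
    #|[pred m : 'I_(2 ^ size s).-1 | C (pt (trunc_log 2 m.+1))]| =
    #|[pred m : 'I_(2 ^ size s).-1 |
       [pred j | (j < size s)%N && C (pt j)] (trunc_log 2 m.+1)]|.
  by apply: eq_card => m; rewrite !inE size_lt.
have lt_i j : P j -> (A (pt i) && B (pt j)) || (B (pt i) && A (pt j)) ->
    (j < i)%N.
  move=> Pj; rewrite ltn_neqAle i_max// andbT; apply: contraL => /eqP ->.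
  by apply/negP => /orP[]/andP[]; [move=> /AB/negP|move=> + /AB/negP].
move: eqAB; rewrite !card_in; apply/eqP; rewrite neq_ltn.
case/orP: ABi => [Ai|Bi]; apply/orP; [right|left].
  apply: (ltn_card_trunc_log i_s); first by rewrite /= i_s.
  by move=> j /andP[js Bj]; apply: lt_i; rewrite /P ?js ?Ai Bj ?orbT.
apply: (ltn_card_trunc_log i_s); first by rewrite /= i_s.
by move=> j /andP[js Aj]; apply: lt_i; rewrite /P ?js ?Bi Aj ?orbT.
Qed.

(** * The small weight and the embedding *)

Lemma finite_mdist_lbound (R : realType) (X : metricType R) :
  finite_set [set: X] ->
  exists e : {posnum R}, forall x y : X, x != y -> e%:num < mdist x y.
Proof.
move=> /finite_seqP[s sE].
have in_s x : x \in s by have : [set: X] x by []; rewrite sE.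
have [e e_lt] : exists e : {posnum R},
    forall r, r \in [seq mdist x y | x <- s, y <- s] -> 0 < r -> e%:num < r.
  elim: [seq _ | x <- s, y <- s] => [|r l [e IH]]; first by exists 1%:pos.
  have [r_gt0|r_le0] := ltP 0 r.
    have h_gt0 : 0 < Num.min e%:num r / 2 by rewrite divr_gt0// lt_min r_gt0 gt0.
    have h_lt : Num.min e%:num r / 2 < Num.min e%:num r.
      by rewrite ltr_pdivrMr// ltr_pMr ?ltr1n// lt_min r_gt0 gt0.
    exists (PosNum h_gt0) => q; rewrite inE => /orP[/eqP -> _|/IH + q0] /=.
      by apply: lt_le_trans h_lt _; rewrite ge_min lexx orbT.
    move=> /(_ q0); apply: lt_trans.
    by apply: lt_le_trans h_lt _; rewrite ge_min lexx.
  exists e => q; rewrite inE => /orP[/eqP ->|]; first by rewrite ltNge r_le0.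
  exact: IH.
exists e => x y xy; apply: e_lt; last by rewrite mdist_gt0.
by apply/allpairsP; exists (x, y).
Qed.

Theorem proposition3p9 (R : realType) (X : metricType R)
    (X_finite : finite_set [set: X]) (X_ultra : ultrametric X) :
  exists phi : X -> ultra_class R,
    forall x y : X, u_GH (phi x) (phi y) = mdist x y.
Proof.
have [[x0]|X0] := pselect (inhabited X); last first.
  by exists (fun x => False_rect _ (X0 (inhabits x))) => x; case: X0.
have [e e_lt] := finite_mdist_lbound X_finite.
have [L [pt ptP]] := separating_labelling x0 X_finite.
(* Otherwise the singleton of [x] and the empty set would both have no label. *)
have pt_surj x : exists l, pt l = x.
  apply: contrapT => /forallNP ptN.
  apply: (ptP (pred1 x) pred0) => //; first by exists x; rewrite /= eqxx.
  by apply: eq_card => l; rewrite !inE; apply/eqP/ptN.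
have /choice[w wE] : forall p : X * X, exists r : {posnum R},
    r%:num = if p.1 == p.2 then e%:num else mdist p.1 p.2.
  move=> [x y] /=; case: (eqVneq x y) => [_|]; first by exists e.
  by rewrite -mdist_gt0 => xy; exists (PosNum xy).
pose wt x l := w (x, pt l); have [l0 _] := pt_surj x0.
exists (fun x => class_of (star_cus (wt x) l0)) => x y; rewrite u_GH_class_of.
(* For thresholds above [e], replacing the weight 0 by [e] changes no comparison. *)
have wt_lt (z : X) (t : R) l :
    e%:num < t -> ((wt z l)%:num < t) = (mdist z (pt l) < t).
  rewrite wE /=; case: (eqVneq z (pt l)) => [<-|//]; rewrite mdistxx => et.
  by rewrite et (lt_trans _ et).
have [->|xy] := eqVneq x y.
  by rewrite mdistxx; apply: le_anti; rewrite u_GH_space_ge0 u_GH_star_le//; left.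
apply: le_anti; apply/andP; split.
  apply: u_GH_star_le => [|l]; first exact: mdist_ge0.
  (* Used in both directions, this shows that the distances from [x] and [y] to [pt l] are equal as
     soon as one exceeds [mdist x y]. *)
  have ext z z' : mdist x y < mdist z (pt l) -> mdist x y = mdist z z' ->
      mdist z (pt l) <= mdist z' (pt l).
    move=> lt zz'; have := X_ultra z z' (pt l).
    by rewrite -zz' le_max leNgt lt.
  have e_le := ltW (e_lt _ _ xy).
  have wt_le z : mdist z (pt l) <= mdist x y -> (wt z l)%:num <= mdist x y.
    by rewrite wE /=; case: ifP.
  have [xl|xl] := leP (mdist x (pt l)) (mdist x y).
    have [yl|yl] := leP (mdist y (pt l)) (mdist x y).
      by right; rewrite !wt_le.
    have := ext y x yl (metric_sym _ _).
    by move=> /(lt_le_trans yl); rewrite ltNge xl.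
  have yl := ext x y xl erefl.
  have ly := ext y x (lt_le_trans xl yl) (metric_sym _ _).
  left; apply/val_inj; rewrite /= !wE /=.
  have xl0 : x != pt l.
    by apply: contraTneq xl => <-; rewrite mdistxx -leNgt mdist_ge0.
  have yl0 : y != pt l.
    apply: contraTneq (lt_le_trans xl yl) => <-.
    by rewrite mdistxx -leNgt mdist_ge0.
  by rewrite (negbTE xl0) (negbTE yl0); apply: le_anti; rewrite yl ly.
rewrite leNgt; apply/negP => /u_GH_star_lt H.
have et := e_lt _ _ xy.
have near_self z : exists l, (wt z l)%:num < mdist x y.
  by have [l ptl] := pt_surj z; exists l; rewrite wt_lt// ptl mdistxx mdist_gt0.
have {H} eq_card_far := H (near_self x) (near_self y).
(* Equal numbers of heavy labels mean, by complement, equal numbers of labels over the two open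
   balls. *)
have card_near z : #|[pred l | mdist z (pt l) < mdist x y]| =
    #|~: [set l | mdist x y <= (wt z l)%:num]%SET|.
  by apply: eq_card => l; rewrite !inE -ltNge wt_lt.
apply: (ptP [pred z | mdist x z < mdist x y] [pred z | mdist y z < mdist x y]).
- move=> z /= xz; apply/negP => yz.
  have := X_ultra x z y; rewrite [mdist z y]metric_sym leNgt gt_max.
  by rewrite xz yz.
- by exists x; rewrite /= mdistxx mdist_gt0.
- rewrite !card_near; apply/eqP.
  rewrite -(eqn_add2l #|[set l | mdist x y <= (wt x l)%:num]%SET|).
  by rewrite {2}eq_card_far !cardsC.
Qed.
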